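(* For every integer $k\ge1$ there is a universal constant $\beta_k$ (depending only on $k$), which can be set no greater than $3^k+3^{k-1}-2^k$, such that the following holds. Let $N\ge1$, $V=\mathbb{R}^k$, let $T\subset V^N$ be a bounded set, and let $h_1,\ldots,h_N$ be functions $V\to\mathbb{R}$ such that each $h_i$ is $(M_i,\ell_\infty)$-Lipschitz with $h_i(\boldsymbol{0})=0$. For $j\le k$, let $T_j=\{(t_{1j},\ldots,t_{Nj}): (\boldsymbol{t}_1,\ldots,\boldsymbol{t}_N)\in T\}\subset\mathbb{R}^N$. Let $\varepsilon_1,\ldots,\varepsilon_N$ be independent Rademacher variables. Then $$ \mathsf{E}\sup_{\boldsymbol{t}\in T}\Big|\sum_{i\le N}\varepsilon_i h_i(\boldsymbol{t}_i)\Big| \le \beta_k\sum_{j\le k}\mathsf{E}\sup_{\boldsymbol{s}\in T_j}\Big|\sum_{i\le N}\varepsilon_i M_i s_i\Big|. $$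
   Context: Elements of $V^N$ are written $\boldsymbol{t}=(\boldsymbol{t}_1,\ldots,\boldsymbol{t}_N)$ with $\boldsymbol{t}_i=(t_{i1},\ldots,t_{ik})\in V=\mathbb{R}^k$. A Rademacher variable $\varepsilon$ satisfies $\Pr\{\varepsilon=1\}=\Pr\{\varepsilon=-1\}=1/2$. A function $h:\mathbb{R}^k\to\mathbb{R}$ is called $(M,\ell_\infty)$-Lipschitz if $|h(\boldsymbol{t})-h(\boldsymbol{s})|\le M\|\boldsymbol{t}-\boldsymbol{s}\|_\infty$ for all $\boldsymbol{s},\boldsymbol{t}\in\mathbb{R}^k$, where $\|\boldsymbol{s}\|_\infty=\max_{j\le k}|s_j|$. *)

(* Defs.v *)
From HB Require Import structures.
From mathcomp Require Import all_boot all_order all_algebra.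
From mathcomp Require Import all_classical all_reals all_analysis.

Set Implicit Arguments.
Unset Strict Implicit.
Unset Printing Implicit Defensive.

Import Order.TTheory GRing.Theory Num.Theory.
Import numFieldNormedType.Exports.

Local Open Scope classical_set_scope.
Local Open Scope ring_scope.

Definition mutually_independent (d : measure_display) (Omega : measurableType d)
    (R : realType) (P : probability Omega R) (I : finType)
    (X : I -> {RV P >-> R}) : Prop :=
  forall (J : {set I}) (A : I -> set R),
    (forall i, i \in J -> measurable (A i)) ->
    P (\bigcap_(i in [set` J]) X i @^-1` A i) =
    (\prod_(i in J) P (X i @^-1` A i))%E.

Definition rademacher (d : measure_display) (Omega : measurableType d)
    (R : realType) (P : probability Omega R) (X : {RV P >-> R}) : Prop :=
  P (X @^-1` [set 1]) = (2^-1)%:E /\ P (X @^-1` [set -1]) = (2^-1)%:E.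

(* An element of (R^k)^N is an N x k matrix t, whose rows are the vectors t_i.
   The library norm of 'rV[R]_k, used by the predicate .-lipschitz, is the
   maximum norm. *)
Definition coordinate_set (R : realType) (N k : nat) (T : set 'M[R]_(N, k))
    (j : 'I_k) : set 'rV[R]_N :=
  [set \row_(i < N) t i j | t in T].

(* Main.v *)
(* The constant beta = 2 works for every k.  Since the supremum over T of a sum
   of functions is convex, replacing one term eps_i h_i(t_i) by
   sum_j eps_ij M_i t_ij, with fresh independent signs, does not decrease the
   average: for a pair of points s, t of T pick the coordinate j realising
   ||t_i - s_i||_oo; the signs of the other coordinates can only increase the
   average, by Jensen's inequality. After all the replacements, subadditivity of
   the supremum splits the average into its k coordinates.  The factor 2 comes
   from the absolute value: with 0 adjoined to T the suprema are nonnegative, so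
   sup |g| <= sup g + sup (- g). *)
Require Import Defs.
From HB Require Import structures.
From mathcomp Require Import all_boot all_order all_algebra.
From mathcomp Require Import all_classical all_reals all_analysis.
From mathcomp Require Import measurable_realfun lra.

Set Implicit Arguments.
Unset Strict Implicit.
Unset Printing Implicit Defensive.

Import Order.TTheory GRing.Theory Num.Theory.
Import numFieldNormedType.Exports.

Local Open Scope classical_set_scope.
Local Open Scope ring_scope.

(** * Suprema of bounded functions over a set *)

Section supremum_of_bounded_functions.
Context {R : realType} {X : Type} (A : set X).
Implicit Types (f g p : X -> R).

Definition bounded_on f := exists B, forall x, A x -> `|f x| <= B.

Lemma bounded_onD f g : bounded_on f -> bounded_on g -> bounded_on (f + g).
Proof.
move=> [B fB] [C gC]; exists (B + C) => x Ax.
by rewrite (le_trans (ler_normD _ _))// lerD ?fB ?gC.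
Qed.

Lemma bounded_onN f : bounded_on f -> bounded_on (- f).
Proof. by move=> [B fB]; exists B => x Ax; rewrite normrN fB. Qed.

Lemma bounded_onB f g : bounded_on f -> bounded_on g -> bounded_on (f - g).
Proof. by move=> bf bg; exact/bounded_onD/bounded_onN. Qed.

Lemma bounded_on0 : bounded_on 0.
Proof. by exists 0 => x _; rewrite normr0. Qed.

Lemma bounded_on_norm f : bounded_on f -> bounded_on (fun x => `|f x|).
Proof. by move=> [B fB]; exists B => x Ax; rewrite normr_id fB. Qed.

Lemma bounded_on_lincomb (I : finType) (c : I -> R) (f : I -> X -> R) :
  (forall i, bounded_on (f i)) -> bounded_on (fun x => \sum_i c i * f i x).
Proof.
move=> /choice[B fB]; exists (\sum_i `|c i| * B i) => x Ax.
apply: le_trans (ler_norm_sum _ _ _) _; apply: ler_sum => i _.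
by rewrite normrM ler_wpM2l// fB.
Qed.

Lemma sup_image_ub f x : bounded_on f -> A x -> f x <= sup (f @` A).
Proof.
move=> [B fB] Ax; apply: ub_le_sup; last by exists x.
by exists B => _ [y Ay <-]; rewrite (le_trans (ler_norm _))// fB.
Qed.

Lemma sup_image_le f c : A !=set0 -> (forall x, A x -> f x <= c) ->
  sup (f @` A) <= c.
Proof.
move=> [x Ax] fc; apply: ge_sup; first by exists (f x); exists x.
by move=> _ [y Ay <-]; exact: fc.
Qed.

Lemma sup_image_ge0 f : bounded_on f -> (forall x, A x -> 0 <= f x) ->
  0 <= sup (f @` A).
Proof.
(* The empty set has supremum 0 by default. *)
move=> bf f0; have [->|/set0P[x Ax]] := eqVneq A set0.
  by rewrite image_set0 sup0.
by rewrite (le_trans (f0 x Ax))// sup_image_ub.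
Qed.

Hypothesis A0 : A !=set0.

Lemma sup_image_sum (J : finType) (f : J -> X -> R) :
  (forall j, bounded_on (f j)) ->
  sup ((\sum_j f j) @` A) <= \sum_j sup (f j @` A).
Proof.
move=> bf; apply: sup_image_le => // x Ax; rewrite fct_sumE.
by apply: ler_sum => j _; exact: sup_image_ub.
Qed.

(** Jensen's inequality for one sign: [f] is the midpoint of [f + p] and [f - p]. *)
Lemma sup_image_midpoint f p : bounded_on f -> bounded_on p ->
  sup (f @` A) <= (sup ((f + p) @` A) + sup ((f - p) @` A)) / 2.
Proof.
move=> bf bp; apply: sup_image_le => // x Ax.
have := sup_image_ub (bounded_onD bf bp) Ax.
have := sup_image_ub (bounded_onB bf bp) Ax.
by rewrite !fctE; lra.
Qed.

End supremum_of_bounded_functions.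

(* [radsup A u s f] is the average of sup_A (f +- u_i1 +- ... +- u_in) over all
   choices of signs, where s = [:: i1; ...; in]. *)
Fixpoint radsup {R : realType} {X I : Type} (A : set X) (u : I -> X -> R)
    (s : seq I) (f : X -> R) : R :=
  if s is i :: s' then (radsup A u s' (f + u i) + radsup A u s' (f - u i)) / 2
  else sup (f @` A).

(** * Sign averages: monotonicity, contraction and splitting *)

Section radsup_theory.
Context {R : realType} {X : Type} {I : eqType} (A : set X) (A0 : A !=set0).
Variable u : I -> X -> R.
Hypothesis bu : forall i, bounded_on A (u i).
Implicit Types (f g p : X -> R) (s : seq I).

Lemma sup_le_radsup s f : bounded_on A f -> sup (f @` A) <= radsup A u s f.
Proof.
elim: s f => [//|i s IHs] f bf /=.
have := IHs _ (bounded_onD bf (bu i)); have := IHs _ (bounded_onB bf (bu i)).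
by have := sup_image_midpoint A0 bf (bu i); lra.
Qed.

(** Jensen's inequality removes every sign but one occurrence of [i]. If the head [k] is not that
    occurrence, it is applied to [f + u i] and [f - u i] in direction [u k]. *)
Lemma radsup1_le s i f : bounded_on A f -> i \in s ->
  radsup A u [:: i] f <= radsup A u s f.
Proof.
elim: s f => [//|k s IHs] f bf; rewrite inE => /predU1P[->|is_] /=.
  have := sup_le_radsup s (bounded_onD bf (bu k)).
  by have := sup_le_radsup s (bounded_onB bf (bu k)); lra.
have := IHs _ (bounded_onD bf (bu k)) is_.
have := IHs _ (bounded_onB bf (bu k)) is_.
have := sup_image_midpoint A0 (bounded_onD bf (bu i)) (bu k).
have := sup_image_midpoint A0 (bounded_onB bf (bu i)) (bu k).
rewrite /= (addrAC f (u i) (u k)) (addrAC f (u i) (- u k)).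
rewrite (addrAC f (- u i) (u k)) (addrAC f (- u i) (- u k)).
by lra.
Qed.

(** Averages over two signs commute. This moves a sign past [s] in the induction of
    [radsup_contraction1]. *)
Lemma radsup_cat_cons s t i f :
  radsup A u (s ++ i :: t) f = radsup A u (i :: s ++ t) f.
Proof.
elim: s f => [//|k s IHs] f /=; rewrite !IHs /=.
rewrite (addrAC f (u i) (u k)) (addrAC f (u i) (- u k)).
by rewrite (addrAC f (- u i) (u k)) (addrAC f (- u i) (- u k)); lra.
Qed.

(* For x, y in A choose i with |p x - p y| <= |u_i x - u_i y|; then
   (f + p) x + (f - p) y is at most (f + u_i) z + (f - u_i) w for
   {z, w} = {x, y}, and by Jensen's inequality the remaining signs can only
   increase the average. *)
Lemma sup_contraction s p f : bounded_on A f ->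
  (forall x y, A x -> A y ->
    exists2 i, i \in s & `|p x - p y| <= `|u i x - u i y|) ->
  (sup ((f + p) @` A) + sup ((f - p) @` A)) / 2 <= radsup A u s f.
Proof.
move=> bf pu; rewrite ler_pdivrMr// -lerBrDr.
apply: sup_image_le => // x Ax; rewrite lerBrDr addrC -lerBrDr.
apply: sup_image_le => // y Ay; rewrite lerBrDr.
have [i is_ pui] := pu x y Ax Ay.
rewrite -ler_pdivrMr// (le_trans _ (radsup1_le bf is_))//=.
have fD z : A z -> f z + u i z <= sup ((f + u i) @` A).
  exact: (sup_image_ub (bounded_onD bf (bu i))).
have fB z : A z -> f z - u i z <= sup ((f - u i) @` A).
  exact: (sup_image_ub (bounded_onB bf (bu i))).
have := fD x Ax; have := fD y Ay; have := fB x Ax; have := fB y Ay.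
have -> : (f + p) x = f x + p x by [].
have -> : (f - p) y = f y - p y by [].
have := ler_norm (p x - p y); move: pui.
by case: (ger0P (u i x - u i y)); lra.
Qed.

(** The signs of [t] occur on both sides; moving them one by one into [f] reduces the claim to
    [sup_contraction]. *)
Lemma radsup_contraction1 s t p f : bounded_on A f ->
  (forall x y, A x -> A y ->
    exists2 i, i \in s & `|p x - p y| <= `|u i x - u i y|) ->
  (radsup A u t (f + p) + radsup A u t (f - p)) / 2 <= radsup A u (s ++ t) f.
Proof.
move=> + pu; elim: t f => [|k t IHt] f bf.
  by rewrite cats0; exact: sup_contraction.
have := IHt _ (bounded_onD bf (bu k)); have := IHt _ (bounded_onB bf (bu k)).
rewrite radsup_cat_cons /=.
rewrite (addrAC f p (u k)) (addrAC f p (- u k)).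
by rewrite (addrAC f (- p) (u k)) (addrAC f (- p) (- u k)); lra.
Qed.

(** The terms are exchanged one at a time: the induction hypothesis treats the tail for [f + p k]
    and [f - p k], then [radsup_contraction1] replaces [p k] by the signs in [g k]. *)
Lemma radsup_contraction (K : Type) (p : K -> X -> R) (g : K -> seq I)
    (r : seq K) f :
  (forall k, bounded_on A (p k)) -> bounded_on A f ->
  (forall k x y, A x -> A y ->
    exists2 i, i \in g k & `|p k x - p k y| <= `|u i x - u i y|) ->
  radsup A p r f <= radsup A u (flatten [seq g k | k <- r]) f.
Proof.
move=> bp bf pu; elim: r f bf => [//|k r IHr] f bf /=.
apply: le_trans (radsup_contraction1 _ bf (pu k)).
have := IHr _ (bounded_onD bf (bp k)); have := IHr _ (bounded_onB bf (bp k)).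
by lra.
Qed.

(** The sign of [i] is attached to the summand [f (c i)]; in every other summand it averages two
    equal terms. Once no sign is left, the supremum is subadditive. *)
Lemma radsup_split (J : finType) (c : I -> J) s (f : J -> X -> R) :
  (forall j, bounded_on A (f j)) ->
  radsup A u s (\sum_j f j) <=
    \sum_j radsup A u [seq i <- s | c i == j] (f j).
Proof.
elim: s f => [|i s IHs] f bf /=; first exact: sup_image_sum.
pose f1 (w : X -> R) j := if j == c i then f j + w else f j.
have sum_f1 w : \sum_j f j + w = \sum_j f1 w j.
  rewrite (bigD1 (c i))//= [RHS](bigD1 (c i))//= /f1 eqxx addrAC.
  by congr (_ + _); apply: eq_bigr => j /negbTE ->.
have bf1 w : bounded_on A w -> forall j, bounded_on A (f1 w j).
  by move=> bw j; rewrite /f1; case: ifP => // _; exact: bounded_onD.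
rewrite !sum_f1.
have := lerD (IHs _ (bf1 _ (bu i))) (IHs _ (bf1 _ (bounded_onN (bu i)))).
rewrite -big_split/= ler_pdivrMr// mulr_suml => /le_trans; apply.
apply: ler_sum => j _; rewrite /f1 eq_sym; case: eqP => _ /=.
  by rewrite divfK.
by rewrite mulr2n mulrDr mulr1.
Qed.

End radsup_theory.

Lemma sum_signs_radsup (R : realType) (X : Type) (I : finType) (A : set X)
    (u : I -> X -> R) :
  \sum_(e : {ffun I -> bool})
    sup ((fun x => \sum_i (-1) ^+ e i * u i x) @` A) =
  2 ^+ #|I| * radsup A u (enum I) 0.
Proof.
(* Signs outside [s] are fixed by [e], those in [s] are left to [radsup]; the sum over [e] will not
   depend on [s]. *)
pose S (s : seq I) (e : {ffun I -> bool}) : X -> R :=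
  fun x => \sum_(i | i \notin s) (-1) ^+ e i * u i x.
have signs s : uniq s ->
    \sum_e radsup A u s (S s e) = \sum_e sup (S [::] e @` A).
  elim: s => [//|i s IHs] /= /andP[is_ /IHs <-].
  (* Flipping the sign at [i] permutes the sign vectors and exchanges the terms with [+ u i] and
     [- u i]. *)
  pose flip (e : {ffun I -> bool}) : {ffun I -> bool} :=
    [ffun k => (k == i) (+) e k].
  have flipK : involutive flip.
    by move=> e; apply/ffunP => k; rewrite !ffunE addbA addbb.
  have S_step e : S s e = S (i :: s) e + (fun x => (-1) ^+ e i * u i x).
    apply/funext => x; rewrite fctE /S (bigD1 i)//= addrC; congr (_ + _).
    by apply: eq_bigl => k; rewrite inE negb_or andbC.
  have S_flip e : S (i :: s) (flip e) = S (i :: s) e.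
    apply/funext => x; apply: eq_bigr => k; rewrite inE negb_or => /andP[ki _].
    by rewrite ffunE (negbTE ki).
  apply: (mulIf (_ : 2 != 0 :> R)) => //; rewrite mulr_suml.
  rewrite [RHS]mulr_natr mulr2n [X in _ = _ + X](reindex_inj (inv_inj flipK)).
  rewrite -big_split/=.
  apply: eq_bigr => e _; rewrite divfK// !S_step S_flip ffunE eqxx.
  have -> : (fun x => (-1) ^+ e i * u i x) = (-1) ^+ e i *: u i by [].
  have -> : (fun x => (-1) ^+ (true (+) e i) * u i x) =
    (-1) ^+ (true (+) e i) *: u i by [].
  case: (e i); rewrite /= !(expr1, expr0) scaleN1r scale1r //.
  by rewrite addrC.
have := signs _ (enum_uniq I); rewrite /S => <-.
rewrite (eq_bigr (fun=> radsup A u (enum I) 0)); last first.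
  move=> e _; congr radsup; apply/funext => x.
  by rewrite big_pred0// => i; rewrite mem_enum.
by rewrite sumr_const card_ffun card_bool -natrX mulr_natl.
Qed.

(** * Contraction for sums over all sign vectors *)

Section contraction_of_sign_averages.
Context {R : realType} {X : Type} {I J : finType}.
Implicit Types (A : set X) (e : {ffun I -> bool}).

Definition signed_sum (u : I -> X -> R) e : X -> R :=
  fun x => \sum_i (-1) ^+ e i * u i x.

Lemma bounded_on_signed_sum A (u : I -> X -> R) e :
  (forall i, bounded_on A (u i)) -> bounded_on A (signed_sum u e).
Proof. exact: bounded_on_lincomb. Qed.

Lemma radsup_map (K L : Type) A (u : L -> X -> R) (c : K -> L) s f :
  radsup A u [seq c k | k <- s] f = radsup A (u \o c) s f.
Proof. by elim: s f => [//|k s IHs] f /=; rewrite !IHs. Qed.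

(** Absolute values are removed on the left at the cost of the factor 2; contraction and splitting
    are applied without them, and restoring them on the right only increases the bound. *)
Lemma sign_average_contraction A (x0 : X) (p : I -> X -> R)
    (u : I * J -> X -> R) :
  (forall i, bounded_on A (p i)) -> (forall ij, bounded_on A (u ij)) ->
  (forall i, p i x0 = 0) -> (forall ij, u ij x0 = 0) ->
  (forall i x y, exists j, `|p i x - p i y| <= `|u (i, j) x - u (i, j) y|) ->
  \sum_e sup [set `|signed_sum p e x| | x in A] <=
  2 * \sum_j \sum_e sup [set `|signed_sum (fun i => u (i, j)) e x| | x in A].
Proof.
move=> bp bu p0 u0 pu; pose B := A `|` [set x0].
have bB f : f x0 = 0 -> bounded_on A f -> bounded_on B f.
  (* The maximum with 0 serves [x0]: [C] may be negative if [A] is empty. *)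
  move=> f0 [C fC]; exists (Num.max 0 C) => x [Ax|->].
    by rewrite le_max fC ?orbT.
  by rewrite f0 normr0 le_max lexx.
have B0 : B !=set0 by exists x0; right.
have bpB i : bounded_on B (p i) by exact: bB.
have buB ij : bounded_on B (u ij) by exact: bB.
have s0 (v : I -> X -> R) e : (forall i, v i x0 = 0) -> signed_sum v e x0 = 0.
  by move=> v0; rewrite /signed_sum big1// => i _; rewrite v0 mulr0.
pose neg e : {ffun I -> bool} := [ffun i => ~~ e i].
have negK : involutive neg.
  by move=> e; apply/ffunP => i; rewrite !ffunE negbK.
have sN v e x : signed_sum v (neg e) x = - signed_sum v e x.
  rewrite /signed_sum -sumrN; apply: eq_bigr => i _.
  by rewrite ffunE -mulNr; case: (e i); rewrite /= ?(expr0, expr1, opprK).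
(* Since the suprema over [B] are nonnegative, [|g|] is at most the sum of those of [g] and [- g];
   reindexing by [neg] shows that both have the same total over [e]. *)
have left : \sum_e sup [set `|signed_sum p e x| | x in A] <=
    2 * \sum_e sup (signed_sum p e @` B).
  rewrite mulr_natl mulr2n [X in _ <= _ + X](reindex_inj (inv_inj negK)).
  rewrite -big_split; apply: ler_sum => e _ /=.
  have ub e' x : B x -> signed_sum p e' x <= sup (signed_sum p e' @` B).
    exact: (sup_image_ub (bounded_on_signed_sum _ bpB)).
  have ge0 e' : 0 <= sup (signed_sum p e' @` B).
    by rewrite -(s0 p e' p0) ub//; right.
  have [->|/set0P A0] := eqVneq A set0.
    by rewrite image_set0 sup0 addr_ge0.
  apply: sup_image_le => // x Ax; rewrite ler_norml; apply/andP.
  have Bx : B x by left.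
  have := ub e x Bx; have := ub (neg e) x Bx.
  have := ge0 e; have := ge0 (neg e).
  by rewrite sN; split; lra.
apply: (le_trans left); rewrite ler_pM2l//.
rewrite (sum_signs_radsup B p).
(* This is the list that [radsup_contraction] produces; its pairs with second entry [j] form a copy
   of [I]. *)
pose L := flatten [seq [seq (i, j) | j <- enum J] | i <- enum I].
have L_j j : [seq ij <- L | ij.2 == j] = [seq (i, j) | i <- enum I].
  rewrite filter_flatten -map_comp -[RHS]flatten_map1; congr flatten.
  apply: eq_map => i /=; rewrite filter_map /=.
  by rewrite (@eq_filter _ _ (pred1 j))// filter_pred1_uniq
    ?enum_uniq ?mem_enum.
have contr : radsup B p (enum I) 0 <= radsup B u L 0.
  apply: radsup_contraction => //; first exact: bounded_on0.
  move=> i x y _ _; have [j pj] := pu i x y; exists (i, j) => //.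
  by rewrite map_f ?mem_enum.
have split : radsup B u L 0 <=
    \sum_j radsup B (fun i => u (i, j)) (enum I) 0.
  have -> : (0 : X -> R) = \sum_(j : J) 0 by rewrite big1.
  apply: (le_trans (radsup_split B0 buB snd L (fun=> bounded_on0 B))).
  by apply: ler_sum => j _; rewrite L_j radsup_map big1.
apply: (le_trans (ler_wpM2l _ (le_trans contr split))) => //.
rewrite mulr_sumr; apply: ler_sum => j _.
rewrite -sum_signs_radsup; apply: ler_sum => e _.
have bue : bounded_on A (fun x => `|signed_sum (fun i => u (i, j)) e x|).
  by apply: bounded_on_norm; exact: bounded_on_signed_sum.
apply: sup_image_le => // x [Ax|->].
  exact: le_trans (ler_norm _) (sup_image_ub bue Ax).
(* At [x0] the signed sum is 0, at most the supremum of an absolute value, even for empty [A]. *)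
apply: le_trans (sup_image_ge0 bue _) => //=.
by rewrite big1// => i _; rewrite u0 mulr0.
Qed.

End contraction_of_sign_averages.

(** * Expectations of functions of independent signs *)

Section integral_over_a_finite_partition.
Local Open Scope ereal_scope.
Context d (T : measurableType d) (R : realType).

Import HBNNSimple.

(* The integral of a nonnegative [f], measurable or not, is the supremum of the
   integrals of the simple functions below [f]. *)
Lemma ge0_integral_full_set (mu : {measure set T -> \bar R}) (D : set T)
    (f : T -> \bar R) :
  measurable D -> mu (~` D) = 0 -> (forall x, 0 <= f x) ->
  \int[mu]_x f x = \int[mu]_(x in D) f x.
Proof.
move=> mD muD f0; rewrite [RHS]integral_mkcond.
have fD0 x : 0 <= (f \_ D) x by apply: erestrict_ge0.
rewrite !ge0_integralTE//; apply/eqP; rewrite eq_le; apply/andP; split.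
- apply: ge_ereal_sup => _ [h /= hf <-]; apply: ereal_sup_ubound.
  (* Cutting [h] down to [D] puts it below the restriction of [f] and keeps its integral, as the
     complement of [D] is null. *)
  exists (proj_nnsfun h mD) => [x|].
    rewrite /= patchE; case: ifPn => xD.
      by rewrite /= mindicE xD mulr1.
    by rewrite /= mindicE (negbTE xD) mulr0.
  rewrite -!integralT_nnsfun.
  transitivity (\int[mu]_(x in D) (h x)%:E).
    by rewrite [RHS]integral_nnsfun// mrestrict integralT_nnsfun.
  rewrite [RHS](@ge0_negligible_integral _ _ _ mu setT (~` D))//.
  - by rewrite setTD setCK.
  - exact: measurableC.
  - exact/measurable_EFinP.
  - by move=> x _; rewrite lee_fin.
- apply: le_ereal_sup => _ [h /= hf <-]; exists h => // x.
  by rewrite (le_trans (hf x))// patchE; case: ifP.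
Qed.

Lemma integral_finite_partition (mu : {measure set T -> \bar R}) (E : finType)
    (A : E -> set T) (c : E -> R) (f : T -> R) :
  (forall e, measurable (A e)) ->
  (forall e1 e2 x, A e1 x -> A e2 x -> e1 = e2) ->
  (forall e, 0 <= c e)%R -> (forall e x, A e x -> f x = c e) ->
  \int[mu]_(x in \bigcup_e A e) (f x)%:E = \sum_e (c e)%:E * mu (A e).
Proof.
move=> mA tA c0 fc; rewrite integral_mkcond.
transitivity (\int[mu]_x \sum_e (c e)%:E * (\1_(A e) x)%:E).
  apply: eq_integral => x _; rewrite patchE; case: ifPn => [|xA].
    rewrite inE => -[e _ Aex]; rewrite (bigD1 e)//= big1 ?adde0.
      by rewrite indicE mem_set// mule1 (fc e).
    move=> e' /eqP e'e; rewrite indicE memNset ?mule0// => Ae'x.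
    by apply: e'e; exact: tA Aex.
  rewrite big1// => e _; rewrite indicE memNset ?mule0// => Aex.
  by move/negP: xA => xA; apply: xA; rewrite inE; exists e.
rewrite ge0_integral_sum//; last 2 first.
- move=> e; apply: measurable_funeM; apply/measurable_EFinP.
  exact: measurable_indic.
- by move=> e x _; rewrite -EFinM lee_fin mulr_ge0.
apply: eq_bigr => e _; rewrite ge0_integralZl_EFin//.
- by rewrite integral_indic// setIT.
- by apply/measurable_EFinP; exact: measurable_indic.
Qed.

(** The signs form the vector [e] on the event [A e], of probability [2^-|I|] by independence; these
    disjoint events cover almost everything. *)
Lemma expectation_rademacher (P : probability T R) (I : finType)
    (eps : I -> {RV P >-> R}) (F : (I -> R) -> R) :
  mutually_independent eps -> (forall i, rademacher (eps i)) ->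
  (forall a, 0 <= F a)%R ->
  'E_P[fun w => F (fun i => eps i w)] =
  ((2 ^+ #|I|)^-1 * \sum_(e : {ffun I -> bool}) F (fun i => (-1) ^+ e i))%:E.
Proof.
move=> indep rad F0; rewrite unlock.
pose A (e : {ffun I -> bool}) : set T :=
  \bigcap_(i in [set` [set: I]%SET]) eps i @^-1` [set (-1) ^+ e i]%R.
have AE e w : A e w <-> forall i, eps i w = ((-1) ^+ e i)%R.
  by split=> [Aew i|Aew i _]; [exact: (Aew i (finset.in_setT _))|exact: Aew].
have PA e : P (A e) = ((2 ^+ #|I|)^-1)%:E.
  rewrite (indep _ (fun i => [set (-1) ^+ e i]%R))//.
  rewrite (eq_bigr (fun=> (2^-1)%:E)).
    by rewrite prodEFin prodr_const cardsT exprVn.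
  by move=> i _; case: (rad i) => p1 pN1; case: (e i).
have mA e : measurable (A e).
  by apply: fin_bigcap_measurable => // i _; exact: measurable_funPTI.
have tA e1 e2 w : A e1 w -> A e2 w -> e1 = e2.
  move=> /AE a1 /AE a2; apply/ffunP => i.
  by apply: (@signr_inj R); rewrite -a1 -a2.
have mD : measurable (\bigcup_e A e).
  by apply: fin_bigcup_measurable.
have PD : P (~` \bigcup_e A e) = 0.
  (* The mass of the union is computed as the integral of 1 over the partition. *)
  rewrite probability_setC//.
  have := @integral_finite_partition P _ A (fun=> 1%R) (fun=> 1%R) mA tA.
  rewrite integral_cst// mul1e => -> //.
  rewrite (eq_bigr (fun=> ((2 ^+ #|I|)^-1)%:E)) => [|e _]; last first.
    by rewrite mul1e; exact: PA.
  rewrite (sumEFin _ _ (fun=> (2 ^+ #|I|)^-1))%R sumr_const card_ffun card_bool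
    -[X in _ - X%:E]mulr_natl natrX.
  by rewrite divff ?subee// expf_neq0.
rewrite (ge0_integral_full_set mD PD) => [|w]; last by rewrite lee_fin.
pose c (e : {ffun I -> bool}) := F (fun i => (-1) ^+ e i)%R.
rewrite (integral_finite_partition P (c := c) mA tA)//.
- rewrite mulr_sumr -sumEFin; apply: eq_bigr => e _.
  by rewrite mulrC EFinM; congr (_ * _); exact: PA.
- by move=> e; exact: F0.
- move=> e w /AE Aew; congr F; apply/funext => i; exact: Aew.
Qed.

End integral_over_a_finite_partition.

(** * The contraction inequality for Lipschitz functions of vectors *)

Theorem theorem2p2 (R : realType) (k : nat) (k_ge1 : (1 <= k)%N) :
  exists beta : R,
    beta <= 3 ^+ k + 3 ^+ (k - 1) - 2 ^+ k /\
    forall (N : nat) (N_ge1 : (1 <= N)%N)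
      (T : set 'M[R]_(N, k)) (T_bounded : bounded_set T)
      (M : 'I_N -> R) (h : 'I_N -> 'rV[R]_k -> R)
      (h_lipschitz : forall i, (M i).-lipschitz (h i))
      (h_0 : forall i, h i 0 = 0)
      (d : measure_display) (Omega : measurableType d)
      (P : probability Omega R) (eps : 'I_N -> {RV P >-> R})
      (eps_independent : mutually_independent eps)
      (eps_rademacher : forall i, rademacher (eps i)),
    ('E_P[fun w => sup [set `|\sum_(i < N) eps i w * h i (row i t)|%R | t in T]]
     <= beta%:E *
        \sum_(j < k)
          'E_P[fun w => sup [set `|\sum_(i < N) eps i w * M i * s 0 i|%R
                            | s in coordinate_set T j]])%E.
Proof.
exists 2; split.
  (* For [k = n + 1] the bound is [4 * 3^n - 2 * 2^n], at least [2 * 3^n] and so at least 2. *)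
  case: k k_ge1 => // n _; rewrite subn1 /= !exprS.
  have : 1 <= 3 ^+ n :> R by rewrite exprn_ege1// ler1n.
  have : 2 ^+ n <= 3 ^+ n :> R by rewrite lerXn2r// ?nnegrE// ler_nat.
  by lra.
move=> N N_ge1 T T_bounded M h h_lipschitz h_0 d Omega P eps indep rad.
pose p i (t : 'M[R]_(N, k)) := h i (row i t).
pose u (ij : 'I_N * 'I_k) (t : 'M[R]_(N, k)) := M ij.1 * t ij.1 ij.2.
have lip i x y : `|h i x - h i y| <= M i * `|x - y|.
  exact: (h_lipschitz i (x, y)).
have entry_le m n (t : 'M[R]_(m, n)) i j : `|t i j| <= `|t|.
  rewrite [leRHS]/Num.Def.normr/= mx_normrE.
  by apply/bigmax_geP; right; exists (i, j).
have bT i j : bounded_on T (fun t : 'M[R]_(N, k) => t i j).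
  (* [bounded_set] gives the bound for every constant strictly above [C]. *)
  have [C [_ TC]] := T_bounded; exists (C + 1) => t Tt.
  by apply: le_trans (entry_le _ _ _ _ _) _; apply: TC Tt; rewrite ltrDl.
have bu ij : bounded_on T (u ij).
  have [C TC] := bT ij.1 ij.2; exists (`|M ij.1| * C) => t Tt.
  by rewrite normrM ler_wpM2l// TC.
have pu i x y : exists j, `|p i x - p i y| <= `|u (i, j) x - u (i, j) y|.
  (* [j] is a coordinate where the maximum norm is attained; if the norm is 0, any coordinate will
     do, and [k_ge1] provides one. *)
  have [xy0|/mx_norm_neq0[[i0 j]]] := eqVneq (mx_norm (row i x - row i y)) 0.
    exists (Ordinal k_ge1); apply: le_trans (lip _ _ _) _.
    by rewrite [`|_ - _|]xy0 mulr0.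
  rewrite ord1 !mxE => /= norm_xy; exists j; apply: le_trans (lip _ _ _) _.
  rewrite [X in _ * X]norm_xy /u /= -mulrBr normrM ler_wpM2r//.
  exact: ler_norm.
have p0 i : p i 0 = 0 by rewrite /p row0 h_0.
have u0 ij : u ij 0 = 0 by rewrite /u mxE mulr0.
have bp i : bounded_on T (p i).
  (* Comparison with the zero matrix bounds [p i t] by some [u (i, j) t]; as [j] depends on [t], the
     absolute values are summed over all [j]. *)
  have := bounded_on_lincomb (fun=> 1) (fun j => bounded_on_norm (bu (i, j))).
  move=> [C TC]; exists C => t Tt; apply: le_trans (TC t Tt).
  have [j] := pu i t 0; rewrite p0 u0 !subr0 => /le_trans; apply.
  rewrite (le_trans _ (ler_norm _))// (bigD1 j)//= mul1r lerDl.
  by apply: sumr_ge0 => j' _; rewrite mul1r.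
pose F (v : 'I_N -> 'M[R]_(N, k) -> R) (a : 'I_N -> R) :=
  sup [set `|\sum_i a i * v i t| | t in T].
have F_ge0 v a : (forall i, bounded_on T (v i)) -> 0 <= F v a.
  move=> bv; apply: sup_image_ge0 => //.
  exact/bounded_on_norm/bounded_on_lincomb.
have Fu j a : sup [set `|\sum_i a i * M i * s 0 i| | s in coordinate_set T j] =
    F (fun i => u (i, j)) a.
  rewrite /coordinate_set image_comp; congr (sup (_ @` _)).
  apply/funext => t /=; congr `|_|; apply: eq_bigr => i _.
  by rewrite mxE /u mulrA.
under [X in (_ <= _ * X)%E]eq_bigr => j _.
  under [X in 'E_P[X]%E]eq_fun => w do rewrite Fu.
  rewrite (expectation_rademacher (F := F (fun i => u (i, j))) indep rad).
  over.
  by move=> a; exact: F_ge0.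
rewrite (expectation_rademacher (F := F p) indep rad); last first.
  by move=> a; exact: F_ge0.
rewrite sumEFin -EFinM lee_fin -mulr_sumr mulrCA ler_pM2l; last first.
  by rewrite invr_gt0 exprn_gt0.
exact: (sign_average_contraction bp bu p0 u0 pu).
Qed.
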